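(* Let $m\in\mathbb{Z}$, let $\boldsymbol{\omega}=(\omega_1,\omega_2,\ldots)$ be a weight vector, and let $\{P_{n,\boldsymbol{\omega}}\}_{n\ge 1}$, the sequence of weighted isobaric polynomials determined by $\boldsymbol{\omega}$, be a sequence of solutions of $\mathfrak{T}_m=0$, i.e. $\mathfrak{T}_m(P_{n,\boldsymbol{\omega}})=0$ for all $n\ge 1$, where $\mathfrak{T}_m = D_{11}-\sum_j t_jD_{2j}-mD_2$. Then either (1) $m=1$ and $2\omega_1=\omega_2$, or (2) $m=2$ and $\omega_1=\omega_2$.
   Context: Let $t_1,t_2,\ldots$ be indeterminates. Write $D_{ij}=\partial^2/\partial t_i\partial t_j$ and $D_j=\partial/\partial t_j$. The sum over $j$ in the operator is over all indeterminates; only finitely many terms act non-trivially on a given polynomial. An exponent vector is a finitely supported vector $\alpha=(\alpha_1,\alpha_2,\ldots)$ of non-negative integers, and $t^\alpha=\prod_j t_j^{\alpha_j}$. A weight vector is a sequence $\boldsymbol{\omega}=(\omega_1,\omega_2,\ldots)$ of integers. For $n\ge 1$, the weighted isobaric polynomial (WIP) of degree $n$ with weight $\boldsymbol{\omega}$ is $$P_{n,\boldsymbol{\omega}}=\sum_{\alpha} A_\alpha t^\alpha,\qquad A_\alpha=\binom{\sum_j\alpha_j}{\alpha_1\ \alpha_2\ \cdots}\frac{\sum_j\alpha_j\omega_j}{\sum_j\alpha_j},$$ where the sum is over all exponent vectors $\alpha$ with $\sum_j j\alpha_j=n$, and the binomial symbol is the multinomial coefficient $(\sum_j\alpha_j)!/\prod_j\alpha_j!$.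 The sequences of weighted isobaric polynomials form a free $\mathbb{Z}$-module (the WIP-module), with addition given by addition of weight vectors.
   Formalization: The weight vector is additionally assumed nonzero: for the zero weight vector every P_n is 0 and solves T_m = 0 for every integer m (e.g. m = 5), so the claim as worded fails there. *)

(* Defs.v *)
From HB Require Import structures.
From mathcomp Require Import all_boot all_order all_algebra.
From mathcomp Require Import finmap.
From mathcomp.multinomials Require Import monalg.

Set Implicit Arguments.
Unset Strict Implicit.
Unset Printing Implicit Defensive.

Import GRing.Theory.
Local Open Scope fset_scope.
Local Open Scope ring_scope.

(** Indices are shifted by one: index [i : nat] stands for the subscript
    [i + 1], so index [0] is the indeterminate t_1 (and the weight omega_1),
    index [1] is t_2 (and omega_2), and so on.

    [expo] is the type of finitely supported exponent vectors and [tpoly] the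
    ring of polynomials over the rationals in the infinitely many
    indeterminates t_1, t_2, ...; rational coefficients are used because of the
    quotient in A_alpha. *)

Notation expo := {cmonom nat}.
Notation tpoly := {malg rat[{cmonom nat}]}.

Definition tvar (i : nat) : tpoly := << ucm i >>.

(** The natural subtraction in [divcm] never truncates when the coefficient
    [a i] is nonzero. *)
Definition pderiv (i : nat) (p : tpoly) : tpoly :=
  \sum_(a <- msupp p) << p@_a *+ a i *g divcm a (ucm i) >>.

Definition tvars (p : tpoly) : {fset nat} :=
  \bigcup_(a <- msupp p) finsupp a.

(** The sum over all j is taken over the indeterminates occurring in [p]; all
    other terms vanish ([pderiv_notin], [sum_tvars]). *)
Definition opT (m : int) (p : tpoly) : tpoly :=
  pderiv 0 (pderiv 0 p)
  - \sum_(j <- tvars p) tvar j * pderiv 1 (pderiv j p)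
  - m%:~R *: pderiv 1 p.

Definition isobar (a : expo) : nat := (\sum_(j <- finsupp a) j.+1 * a j)%N.

(** The finite set of exponent vectors with [isobar a = n]; see
    [mem_isobars]. *)
Definition isobars (n : nat) : {fset expo} :=
  [fset a in [seq [cmonom (f (inord j) : nat) | j in [fset k in iota 0 n]]%M
             | f : {ffun 'I_n.+1 -> 'I_n.+1}] | isobar a == n].

Definition multinom (a : expo) : rat :=
  (mdeg a)`!%:R / \prod_(j <- finsupp a) (a j)`!%:R.

Definition wipcoef (w : nat -> int) (a : expo) : rat :=
  multinom a * ((\sum_(j <- finsupp a) (a j)%:R * (w j)%:~R) / (mdeg a)%:R).

Definition WIP (w : nat -> int) (n : nat) : tpoly :=
  \sum_(a <- isobars n) << wipcoef w a *g a >>.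

Lemma pderivE i p a : (pderiv i p)@_a = p@_(mulcm a (ucm i)) *+ (a i).+1.
Proof.
rewrite /pderiv raddf_sum /=.
under eq_bigr do rewrite mcoeffU.
have key b : (p@_b *+ b i) *+ (divcm b (ucm i) == a)
           = (p@_b *+ b i) *+ (b == mulcm a (ucm i)).
  case: (posnP (b i)) => [->|bi]; first by rewrite mulr0n !mul0rn.
  congr (_ *+ nat_of_bool _); apply/eqP/eqP => [<-|->].
    apply/eqP/cmP => j; rewrite mulcmE divcmE ucmE.
    by case: eqP => [<-|_]; rewrite ?subnK // subn0 addn0.
  by apply/eqP/cmP => j; rewrite divcmE mulcmE addnK.
under eq_bigr do rewrite key.
have [ain|aout] := boolP (mulcm a (ucm i) \in msupp p).
  rewrite (big_fsetD1 _ ain) /= eqxx mulr1n mulcmE ucmE eqxx addn1.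
  rewrite big_seq big1 ?addr0 // => b; rewrite in_fsetD1 => /andP[/negbTE-> _].
  by rewrite mulr0n.
rewrite big_seq big1 => [|b bin]; first by rewrite mcoeff_outdom ?mul0rn.
case: eqP => [eb|_]; last by rewrite mulr0n.
by rewrite -eb bin in aout.
Qed.

Lemma pderiv_notin i p : i \notin tvars p -> pderiv i p = 0.
Proof.
move=> ip; rewrite /pderiv big_seq big1 // => a ap.
have -> : a i = 0%N.
  apply/eqP; rewrite cmE_eq0; apply: contra ip => ia.
  by apply/bigfcupP; exists a; rewrite // ap.
by rewrite mulr0n monalgU0.
Qed.

Lemma sum_tvars (d : {fset nat}) p : tvars p `<=` d ->
  \sum_(j <- tvars p) tvar j * pderiv 1 (pderiv j p)
    = \sum_(j <- d) tvar j * pderiv 1 (pderiv j p).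
Proof.
move=> pd; apply: big_fset_incl => // j jd jp.
by rewrite (pderiv_notin jp) /pderiv msupp0 big_seq_fset0 mulr0.
Qed.

Lemma mem_isobars n a : (a \in isobars n) = (isobar a == n).
Proof.
rewrite !inE /= andb_idl // => /eqP an.
have le_an j : (j.+1 * a j <= n)%N.
  have [ja|] := boolP (j \in finsupp a).
    by rewrite -an /isobar (big_fsetD1 _ ja) leq_addr.
  by rewrite -cmE_eq0 => /eqP ->; rewrite muln0.
apply/imageP; exists [ffun j : 'I_n.+1 => inord (a j)] => //.
apply/eqP/cmP => j; rewrite cmE fsfunE inE mem_iota /= add0n.
have a_le : (a j <= n)%N by apply: leq_trans (le_an j); rewrite leq_pmull.
case: ltnP => jn; first by rewrite ffunE !inordK // ltnS // ltnW.
apply/eqP; rewrite -leqn0 leqNgt; apply/negP => aj.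
by have := le_an j; rewrite leqNgt (leq_trans _ (leq_pmulr _ aj)).
Qed.

Lemma WIPE w n a : (WIP w n)@_a = if isobar a == n then wipcoef w a else 0.
Proof.
rewrite /WIP raddf_sum /=; under eq_bigr do rewrite mcoeffU.
rewrite -mem_isobars; case: ifPn => [ain|aout].
  rewrite (big_fsetD1 _ ain) /= eqxx mulr1n big_seq big1 ?addr0 // => b.
  by rewrite in_fsetD1 => /andP[/negbTE-> _].
rewrite big_seq big1 // => b bin; case: eqP => [eb|//].
by rewrite -eb bin in aout.
Qed.

(** The zero sequence is a solution for every [m], so the classification of
    the solutions has to assume a nonzero weight vector. *)
Lemma opT_WIP0 m n : opT m (WIP (fun=> 0) n) = 0.
Proof.
have -> : WIP (fun=> 0) n = 0.
  apply/malgP => a; rewrite WIPE mcoeff0 /wipcoef.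
  by rewrite big1 ?mul0r ?mulr0 ?if_same // => j _; rewrite mulr0.
have d0 i : pderiv i 0 = 0 by rewrite /pderiv msupp0 big_seq_fset0.
rewrite /opT !d0 scaler0 big1 ?subr0 // => j _.
by rewrite !d0 mulr0.
Qed.

(* Main.v *)
(** Since [sum_j t_j D_j] multiplies [t^a] by [|a| = sum_j a_j], the coefficient
    of [t^a] in [T_m(P)] involves only the coefficients of [P] at [t_1^2 t^a] and
    [t_2 t^a]. With [s_a = sum_j a_j omega_j], a solution therefore satisfies,
    after cancelling the multinomial coefficient of [a],
      [(|a| + 1) (s_a + 2 omega_1) = (|a| + m) (s_a + omega_2)]  for every [a].
    The cases [a = 0] and [a = e_j] give [2 omega_1 = m omega_2] and
    [(m - 1) (omega_j - omega_2) = 0]; if [m <> 1], all weights are equal, and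
    they are nonzero, so [m = 2]. *)

Require Import Defs.
From mathcomp Require Import all_boot all_order all_algebra.
From mathcomp.multinomials Require Import monalg.
From mathcomp Require Import finmap ring.

Import GRing.Theory Num.Theory.

Local Open Scope fset_scope.
Local Open Scope ring_scope.

Lemma mcoeff_tvarM i (p : tpoly) a : (tvar i * p)@_(mulcm a (ucm i)) = p@_a.
Proof.
have key b : (mulcm (ucm i) b == mulcm a (ucm i)) = (b == a).
  apply/eqP/eqP => [/eqP/cmP e|->]; last exact: mulcmC.
  apply/eqP/cmP => j; have := e j; rewrite !mulcmE addnC; exact: addIn.
rewrite mcoeffMl msuppU1 big_seq_fset1.
under eq_bigr do rewrite mcoeffUU mul1r key.
have [ap|ap] := boolP (a \in msupp p); last first.
  rewrite (mcoeff_outdom ap) big_seq big1 // => b bp.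
  by case: eqP => // eb; rewrite -eb bp in ap.
rewrite (big_fsetD1 _ ap) /= eqxx mulr1n big_seq big1 ?addr0 // => b.
by rewrite in_fsetD1 => /andP[/negbTE-> _].
Qed.

Lemma mcoeff_tvarM_eq0 i (p : tpoly) (a : expo) :
  a i = 0%N -> (tvar i * p)@_a = 0.
Proof.
move=> ai; rewrite mcoeffMl msuppU1 big_seq_fset1 big1 // => b _.
case: eqP => // /eqP/cmP/(_ i).
by rewrite mulcmE ucmE eqxx ai.
Qed.

Lemma mcoeff_euler i (p : tpoly) (a : expo) :
  (tvar i * pderiv i p)@_a = p@_a *+ a i.
Proof.
have [ai|ai] := posnP (a i); first by rewrite mcoeff_tvarM_eq0 // ai.
(* Since [a i] is positive, the truncated subtraction in [divcm] is exact. *)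
have <- : mulcm (divcm a (ucm i)) (ucm i) = a.
  apply/eqP/cmP => j; rewrite mulcmE divcmE ucmE.
  by case: eqP => [<-|_]; rewrite ?subnK // subn0 addn0.
by rewrite mcoeff_tvarM pderivE !mulcmE !ucmE eqxx addn1.
Qed.

(** The summand [i == j] is there because the coefficient of [pderiv j p] is read at [t^a] times the
    i-th indeterminate, which raises exponent [j] when [i = j]. *)
Lemma mcoeff_pderiv2 i j (p : tpoly) a :
  (pderiv i (pderiv j p))@_a
    = p@_(mulcm (mulcm a (ucm i)) (ucm j)) *+ ((a j + (i == j)).+1 * (a i).+1).
Proof.
by rewrite [LHS]pderivE [X in X *+ _]pderivE -mulrnA mulcmE ucmE.
Qed.

Lemma pderivC i j (p : tpoly) : pderiv i (pderiv j p) = pderiv j (pderiv i p).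
Proof.
apply/malgP => a; rewrite [LHS]mcoeff_pderiv2 [RHS]mcoeff_pderiv2.
rewrite -(mulcmA a) (mulcmC (ucm i)) mulcmA.
by case: (eqVneq i j) => [->//|ij]; rewrite !addn0 mulnC.
Qed.

Lemma mcoeff_opT m (p : tpoly) (a : expo) :
  (opT m p)@_a =
    p@_(mulcm (mulcm a (ucm 0%N)) (ucm 0%N)) *+ ((a 0%N).+2 * (a 0%N).+1)
    - ((mdeg a)%:R + m%:~R) * (p@_(mulcm a (ucm 1%N)) *+ (a 1%N).+1).
Proof.
have sumE : (\sum_(j <- tvars p) tvar j * pderiv 1 (pderiv j p))@_a
    = (pderiv 1 p)@_a *+ mdeg a.
  (* Neither index set need contain the other; over their union, the sum in the operator and the sum
     defining [mdeg a] can be compared term by term. *)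
  have pd := fsubsetUl (tvars p) (finsupp a).
  rewrite (sum_tvars pd) [LHS]raddf_sum /=.
  rewrite (mdegEw (fsubsetUr (tvars p) (finsupp a))) -[RHS]sumrMnr.
  (* Commuting the derivatives exposes the Euler operator acting on [pderiv 1 p]. *)
  by apply: eq_bigr => j _; rewrite pderivC [LHS]mcoeff_euler.
rewrite /opT [LHS]mcoeffB [X in X - _ = _]mcoeffB [X in _ - X = _]mcoeffZ.
rewrite sumE [X in X - _ - _]mcoeff_pderiv2 eqxx addn1.
by rewrite -[(pderiv 1 p)@_a *+ _]mulr_natl -addrA -opprD -mulrDl pderivE.
Qed.

(** Kept general in [F] to serve both the isobaric degree ([F j = j.+1]) and the weighted sum
    ([F j = w j]). As [i] may lie outside the support of [a], a zero term is added first. *)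
Lemma sum_mulrn_ucmM (V : nmodType) (F : nat -> V) (a : expo) i :
  \sum_(j <- finsupp (mulcm a (ucm i))) F j *+ mulcm a (ucm i) j
    = \sum_(j <- finsupp a) F j *+ a j + F i.
Proof.
have -> : \sum_(j <- finsupp a) F j *+ a j
    = \sum_(j <- i |` finsupp a) F j *+ a j.
  apply: big_fset_incl => [|j _]; first exact: fsubsetU1.
  by rewrite -cmE_eq0 => /eqP->.
have -> : finsupp (mulcm a (ucm i)) = i |` finsupp a.
  by rewrite [LHS]mdomD mdomU fsetUC.
under eq_bigr do rewrite mulcmE mulrnDr.
rewrite big_split /=; congr (_ + _).
rewrite (big_fsetD1 _ (fset1U1 i _)) /= ucmE eqxx.
rewrite big_seq big1 ?addr0 // => j; rewrite in_fsetD1 => /andP[ji _].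
by rewrite ucmE eq_sym (negbTE ji).
Qed.

Lemma isobar_ucmM (a : expo) i : isobar (mulcm a (ucm i)) = (isobar a + i.+1)%N.
Proof.
have isobarE b : isobar b = \sum_(j <- finsupp b) j.+1 *+ b j.
  by apply: eq_bigr => j _; rewrite -mulr_natr natn.
by rewrite !isobarE sum_mulrn_ucmM.
Qed.

(** Raising [a i] by one multiplies the numerator by [(mdeg a).+1] and the denominator by
    [(a i).+1]; the latter is the factor that differentiation produces. *)
Lemma multinom_ucmM (a : expo) i :
  multinom (mulcm a (ucm i)) *+ (a i).+1 = multinom a *+ (mdeg a).+1.
Proof.
have ia : i \in i |` finsupp a by exact: fset1U1.
have -> : multinom a
    = (mdeg a)`!%:R / \prod_(j <- i |` finsupp a) (a j)`!%:R.
  congr (_ / _); apply: big_fset_incl => [|j _]; first exact: fsubsetU1.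
  by rewrite -cmE_eq0 => /eqP->.
rewrite /multinom.
have -> : finsupp (mulcm a (ucm i)) = i |` finsupp a.
  by rewrite [LHS]mdomD mdomU fsetUC.
have -> : mdeg (mulcm a (ucm i)) = (mdeg a).+1.
  by rewrite [LHS]mdegM mdegU addn1.
rewrite !(big_fsetD1 _ ia) /= mulcmE ucmE eqxx addn1.
have -> : \prod_(j <- (i |` finsupp a) `\ i) (mulcm a (ucm i) j)`!%:R
    = \prod_(j <- (i |` finsupp a) `\ i) (a j)`!%:R :> rat.
  apply: eq_big_seq => j; rewrite in_fsetD1 => /andP[ji _].
  by rewrite mulcmE ucmE eq_sym (negbTE ji) addn0.
set P := \prod_(_ <- _) _.
have P0 : P != 0.
  by rewrite prodf_seq_neq0; apply/allP => j _; rewrite pnatr_eq0 -lt0n fact_gt0.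
have fact0 : (a i)`!%:R != 0 :> rat by rewrite pnatr_eq0 -lt0n fact_gt0.
rewrite -[LHS]mulr_natr -[RHS]mulr_natr !factS !natrM.
by field; rewrite P0 fact0 addrC natr1 pnatr_eq0.
Qed.

Lemma multinom_neq0 (a : expo) : multinom a != 0.
Proof.
have fact0 n : n`!%:R != 0 :> rat by rewrite pnatr_eq0 -lt0n fact_gt0.
rewrite mulf_neq0 ?invr_eq0 // prodf_seq_neq0.
by apply/allP => j _; apply: fact0.
Qed.

(** This is [s_a] in the recurrence. *)
Definition wsum (w : nat -> int) (a : expo) : rat :=
  \sum_(j <- finsupp a) (w j)%:~R *+ a j.

(** The factor [(mdeg a).+1] from [multinom_ucmM] cancels the denominator of [wipcoef], which is
    nonzero here. *)
Lemma wipcoef_ucmM w (a : expo) i :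
  wipcoef w (mulcm a (ucm i)) *+ (a i).+1 = multinom a * (wsum w a + (w i)%:~R).
Proof.
have wE b : wipcoef w b = multinom b * (wsum w b / (mdeg b)%:R).
  by congr (_ * (_ / _)); apply: eq_bigr => j _; rewrite mulr_natl.
have -> : wsum w a + (w i)%:~R = wsum w (mulcm a (ucm i)).
  by rewrite [RHS]sum_mulrn_ucmM.
rewrite wE -mulrnAl multinom_ucmM -[X in X * _]mulr_natr -mulrA.
have -> : mdeg (mulcm a (ucm i)) = (mdeg a).+1.
  by rewrite [LHS]mdegM mdegU addn1.
by congr (_ * _); rewrite mulrC divfK // pnatr_eq0.
Qed.

(** Both [t_1^2 t^a] and [t_2 t^a] have isobaric degree [isobar a + 2], so this is the degree at
    which to read the coefficient of [t^a]. *)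
Lemma wip_recurrence m w (a : expo) : opT m (WIP w (isobar a).+2) = 0 ->
  (mdeg a).+1%:R * (wsum w a + (w 0%N)%:~R + (w 0%N)%:~R)
    = ((mdeg a)%:R + m%:~R) * (wsum w a + (w 1%N)%:~R).
Proof.
move=> /(congr1 (mcoeff a)).
rewrite [LHS]mcoeff_opT mcoeff0 !WIPE !isobar_ucmM !addnS !addn0 eqxx.
set b := mulcm a (ucm 0%N).
have b0 : b 0%N = (a 0%N).+1 by rewrite mulcmE ucmE eqxx addn1.
(* The two factors [t_1] are removed one at a time: the first from the WIP coefficient, the second
   from [multinom b]. *)
rewrite -b0 mulrnA wipcoef_ucmM b0 -mulrnAl multinom_ucmM wipcoef_ucmM.
have -> : wsum w b = wsum w a + (w 0%N)%:~R by exact: sum_mulrn_ucmM.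
move/eqP; rewrite subr_eq0 => /eqP e.
apply: (mulfI (multinom_neq0 a)).
by rewrite mulrA mulr_natr e mulrCA.
Qed.

Theorem proposition4p1 (m : int) (w : nat -> int)
    (w_neq0 : exists j : nat, w j <> 0)
    (sol : forall n : nat, (0 < n)%N -> opT m (WIP w n) = 0) :
  (m = 1 /\ 2 * w 0%N = w 1%N) \/ (m = 2 /\ w 0%N = w 1%N).
Proof.
have rec a : (mdeg a).+1%:R * (wsum w a + (w 0%N)%:~R + (w 0%N)%:~R)
    = ((mdeg a)%:R + m%:~R) * (wsum w a + (w 1%N)%:~R).
  exact/wip_recurrence/sol.
have rec1 : 2 * w 0%N = m * w 1%N.
  apply: (@intr_inj rat); have := rec (onecm nat).
  rewrite mdeg1 /wsum mdom1 big_seq_fset0 !add0r mul1r !intrM => <-.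
  by rewrite mulr2n mulrDl mul1r.
have recU j : 2 * (w j + 2 * w 0%N) = (1 + m) * (w j + w 1%N).
  apply: (@intr_inj rat); have := rec (ucm j).
  rewrite mdegU /wsum mdomU big_seq_fset1 cmUU mulr1n => e.
  rewrite !(intrM, intrD) -e; ring.
have wE j : (m - 1) * (w j - w 1%N) = 0.
  have := recU j; rewrite rec1 => e.
  have -> : (m - 1) * (w j - w 1%N)
      = (1 + m) * (w j + w 1%N) - 2 * (w j + m * w 1%N) by ring.
  by rewrite -e subrr.
have [m1|m1] := eqVneq m 1; first by left; rewrite rec1 m1 mul1r.
have {}wE j : w j = w 1%N.
  have /eqP := wE j.
  by rewrite mulf_eq0 subr_eq0 (negbTE m1) subr_eq0 => /eqP.
(* Otherwise all weights would vanish, against [w_neq0]. *)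
have w1 : w 1%N != 0.
  by apply/eqP => w1; case: w_neq0 => j; rewrite wE.
right; split; last exact: wE.
(* With equal weights, [rec1] reads [2 * w 1 = m * w 1]. *)
by apply: (mulIf w1); rewrite -rec1 wE.
Qed.
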